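(* Let $s\geq 12$ and $n\geq \binom{s}{2}+s+1$ be integers. Then $$ex(n,\{K_{2,2},M_{s+1}\})=n+\binom{s}{2}-\left\lceil\frac{s}{2}\right\rceil.$$
   Context: All graphs are finite and simple. $ex(n,\mathscr{F})$ is the maximum number of edges of an $n$-vertex graph containing no member of the family $\mathscr{F}$ as a subgraph. $K_{2,2}$ is the complete bipartite graph with two parts of size $2$ (the 4-cycle), and $M_{s+1}$ is the matching of $s+1$ pairwise disjoint edges. *)

(* Defs.v *)
From mathcomp Require Import all_boot.
Set Implicit Arguments. Unset Strict Implicit. Unset Printing Implicit Defensive.

Definition simple_graph (T : finType) (e : rel T) : Prop :=
  (forall x, ~~ e x x) /\ (forall x y, e x y = e y x).

Definition num_edges (n : nat) (e : rel 'I_n) : nat :=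
  #|[set p : 'I_n * 'I_n | (p.1 < p.2)%N && e p.1 p.2]|.

Definition has_C4 (T : finType) (e : rel T) : Prop :=
  exists a b c d : T,
    [/\ uniq [:: a; b; c; d], e a b, e b c, e c d & e d a].

Definition has_matching (T : finType) (e : rel T) (k : nat) : Prop :=
  exists f : 'I_k -> T * T,
    (forall i, e (f i).1 (f i).2) /\
    uniq ([seq (f i).1 | i <- enum 'I_k] ++ [seq (f i).2 | i <- enum 'I_k]).

Definition C4_Ms_free (T : finType) (e : rel T) (s : nat) : Prop :=
  ~ has_C4 e /\ ~ has_matching e s.+1.

Definition is_ex_C4_M (n s m : nat) : Prop :=
  (exists e : rel 'I_n, [/\ simple_graph e, C4_Ms_free e s & num_edges e = m]) /\
  (forall e : rel 'I_n, simple_graph e -> C4_Ms_free e s -> num_edges e <= m).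

(* Main.v *)
(* Upper bound: choose a largest vertex set S with |S| + nu(G - S) <= s. Then
   nu(G - S) = s - |S| and every vertex of G - S is missed by some maximum
   matching of G - S, so by Gallai's argument "no maximum matching misses both"
   is an equivalence relation containing adjacency, and a maximum matching misses
   at most one vertex of each class: the sum of |K| - 1 over the classes K is at
   most 2(s - |S|). In a C4-free graph a pair of vertices has at most one common
   neighbour, so the sum over v of d_A(v)(d_A(v) - 1) is at most |A|(|A| - 1).
   With A = S this bounds the edges meeting S, and with A = K, together with
   8d <= d(d - 1) + 20, the edges inside K.
   Lower bound: S = {0, ..., s - 1} carries a near-perfect matching, each pair in
   S gets a private outside common neighbour, and all other vertices hang on 0. *)
Require Import Defs.
From mathcomp Require Import all_boot zify.
Set Implicit Arguments. Unset Strict Implicit. Unset Printing Implicit Defensive.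

(** * Matchings encoded as involutions, and exchanges between two of them *)

Section Matchings.
Variables (n : nat) (e : rel 'I_n).
Hypotheses (e_irr : forall x, ~~ e x x) (e_sym : forall x y, e x y = e y x).
Implicit Types (m : {ffun 'I_n -> 'I_n}) (A C S U : {set 'I_n}).

(* A matching is an involution whose fixed points are the missed vertices. *)
Definition matching_in U m :=
  [forall x, (m (m x) == x) && ((m x != x) ==> (x \in U) && e x (m x))].

(** Each matched edge is counted once, at its smaller end. *)
Definition msize m := #|[set x : 'I_n | x < m x]|.

Lemma matching_inP U m :
  reflect ((forall x, m (m x) = x) /\
           (forall x, m x != x -> x \in U /\ e x (m x)))
          (matching_in U m).
Proof.
apply: (iffP forallP) => [H | [mK me] x].
  split=> x; first by case/andP: (H x) => /eqP.
  by move=> mx; case/andP: (H x) => _; rewrite mx => /andP.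
by rewrite mK eqxx; apply/implyP => /me [-> ->].
Qed.

Lemma card_moved m : (forall x, m (m x) = x) ->
  #|[set x | m x != x]| = (msize m).*2.
Proof.
move=> mK.
have m_inj : injective m by apply: (can_inj mK).
have -> : [set x | m x != x] =
    [set x : 'I_n | x < m x] :|: m @: [set x : 'I_n | x < m x].
  apply/setP => x; rewrite !inE; apply/idP/orP => [|[|/imsetP[y]]].
  - rewrite -val_eqE neq_ltn => /orP[lt_mx|]; last by left.
    by right; apply/imsetP; exists (m x); rewrite ?inE mK.
  - by rewrite -val_eqE neq_ltn orbC => ->.
  - by rewrite inE => lt_y ->; rewrite mK -val_eqE neq_ltn lt_y.
rewrite cardsU card_imset // [X in _ - #|pred_of_set X|](_ : _ = set0).
  by rewrite cards0 subn0 addnn.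
apply/setP => x; rewrite !inE; apply/negP => /andP[lt_x /imsetP[y]].
by rewrite inE => lt_y xE; move: lt_x; rewrite xE mK ltnNge ltnW.
Qed.

Lemma matching_of_msize m k : matching_in setT m -> k <= msize m ->
  has_matching e k.
Proof.
move=> /matching_inP[mK me] le_k.
have m_inj : injective m by apply: (can_inj mK).
pose g (i : 'I_k) := @enum_val _ (mem [set x : 'I_n | x < m x]) (widen_ord le_k i).
have g_lt i : g i < m (g i).
  by have := enum_valP (widen_ord le_k i); rewrite inE.
have g_inj : injective g.
  by move=> i j /enum_val_inj /(congr1 val) /= ij; apply: val_inj.
exists (fun i => (g i, m (g i))); split=> /= [i|].
  by case: (me (g i)) => //; rewrite -val_eqE neq_ltn g_lt orbT.
rewrite cat_uniq (map_inj_uniq g_inj) (map_inj_uniq (inj_comp m_inj g_inj)).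
rewrite enum_uniq andbT /=; apply/hasPn => _ /mapP[i _ ->]; apply/negP => /mapP[j _ gE].
by have := g_lt j; rewrite -gE mK ltnNge ltnW.
Qed.

Definition mix C m1 m2 : {ffun 'I_n -> 'I_n} :=
  [ffun x => if x \in C then m1 x else m2 x].

Lemma matching_mix U C m1 m2 :
  {homo m1 : x / x \in C} -> {homo m2 : x / x \in C} ->
  matching_in U m1 -> matching_in U m2 -> matching_in U (mix C m1 m2).
Proof.
move=> C1 C2 /matching_inP[m1K m1e] /matching_inP[m2K m2e].
apply/matching_inP; split=> x; case xC: (x \in C); rewrite !ffunE !xC.
- by rewrite C1 ?xC.
- by case: ifP => [/C2|//]; rewrite m2K xC.
- exact: m1e.
- exact: m2e.
Qed.

(** Exchanging two matchings on [C] only redistributes their edges. Hence if both have maximum size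
    and both mixtures are matchings, the mixtures have maximum size too. *)
Lemma msize_mix C m1 m2 :
  msize (mix C m1 m2) + msize (mix C m2 m1) = msize m1 + msize m2.
Proof.
have msE m : msize m = \sum_(x : 'I_n) (x < m x) by rewrite /msize -sum1dep_card big_mkcond.
rewrite !msE -!big_split /=; apply: eq_bigr => x _.
by rewrite !ffunE; case: ifP => // _; rewrite addnC.
Qed.

(* With [f = M \o N], this says [N (f^i y) = f^-(i+1) y]: the [f]-orbit of a
   vertex [y] missed by [M] is the whole alternating path starting at [y]. *)
Lemma alternating_iter (T : Type) (M N : T -> T) y i :
  involutive M -> involutive N -> M y = y ->
  iter i.+1 (M \o N) (N (iter i (M \o N) y)) = y.
Proof.
move=> MK NK My; elim: i => [|i IHi]; first by rewrite /= NK.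
by rewrite iterSr [X in iter _ _ X](_ : _ = N (iter i (M \o N) y)) //= NK MK.
Qed.

Lemma iter_fix (T : Type) (f : T -> T) y i k :
  iter i f y = y -> iter (k * i) f y = y.
Proof. by move=> fi; elim: k => // k IHk; rewrite mulSn iterD IHk. Qed.

(* If [N] misses [f^i y], then [f^(2i+1) y = y]; two such odd periods differ by
   [2(j - i)], so that [j - i] is a period as well. *)
Lemma alternating_end (T : Type) (M N : T -> T) y i j :
  let f := M \o N in
  involutive M -> involutive N -> M y = y ->
  N (iter i f y) = iter i f y -> N (iter j f y) = iter j f y ->
  iter i f y = iter j f y.
Proof.
move=> f MK NK My.
wlog le_ij : i j / i <= j.
  by move=> H Ni Nj; case/orP: (leq_total i j) => ?; [|symmetry]; apply: H.
move=> Ni Nj.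
have Pi : iter (i.+1 + i) f y = y by rewrite iterD -Ni alternating_iter.
have Pj : iter (j.+1 + j) f y = y by rewrite iterD -Nj alternating_iter.
have P2 : iter ((j - i).*2) f y = y.
  rewrite -[RHS]Pj (_ : j.+1 + j = (j - i).*2 + (i.+1 + i)); last by lia.
  by rewrite iterD Pi.
have Pd : iter (j - i) f y = y.
  have := iter_fix (j - i) Pi.
  rewrite (_ : (j - i) * _ = (j - i) + i * (j - i).*2); last by nia.
  by rewrite iterD iter_fix.
by rewrite -(subnKC le_ij) iterD Pd.
Qed.

(** * Gallai's equivalence relation when every vertex is missed by a maximum matching *)

Section Gallai.
Variables (U : {set 'I_n}) (k : nat).
Hypothesis max_k : forall m, matching_in U m -> msize m <= k.
Hypothesis missed :
  forall v, v \in U -> exists2 m, matching_in U m /\ msize m = k & m v = v.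

Definition joined x y :=
  (x == y) || [forall m, matching_in U m && (msize m == k) ==>
                 ~~ ((m x == x) && (m y == y))].

Lemma joinedPn x y :
  reflect (x != y /\ exists2 m, matching_in U m /\ msize m = k & m x = x /\ m y = y)
          (~~ joined x y).
Proof.
rewrite negb_or negb_forall; apply: (iffP andP) => -[xy].
  case/existsP => m; rewrite negb_imply negbK => /andP[/andP[mU /eqP mk]].
  by case/andP => /eqP mx /eqP my; split=> //; exists m.
case=> m [mU mk] [mx my]; split=> //; apply/existsP; exists m.
by rewrite negb_imply mU mk mx my !eqxx.
Qed.

Lemma joined_refl : reflexive joined.
Proof. by move=> x; rewrite /joined eqxx. Qed.

Lemma joined_sym : symmetric joined.
Proof.
move=> x y; rewrite /joined eq_sym; congr (_ || _).
by apply: eq_forallb => m; rewrite [X in ~~ X]andbC.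
Qed.

(** Suppose a maximum [N] misses [x] and [z], and let a maximum [M] miss [y]. The alternating path
    from [y] can end in only one of [x] and [z]; replacing [N] by [M] along it gives a maximum
    matching that misses [y] and the other one. *)
Lemma joined_trans x y z : y \in U -> joined x y -> joined y z -> joined x z.
Proof.
move=> yU xy yz; apply: contraT => /joinedPn[neq_xz [N [NU Nk] [Nx Nz]]].
have [M [MU Mk] My] := missed yU.
have [MK _] := matching_inP _ _ MU; have [NK _] := matching_inP _ _ NU.
pose f := M \o N; have f_inj : injective f.
  by apply: inj_comp; apply: can_inj; [exact: MK | exact: NK].
(* This orbit is the alternating path: it is closed under [N] by [alternating_iter], and then under
   [M] because [M v = f (N v)]. *)
pose C := [set v | fconnect f y v].
have CN : {homo N : v / v \in C}.
  move=> v; rewrite !inE => /iter_findex <-.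
  rewrite fconnect_sym //; set i := findex _ _ _.
  by rewrite -{2}(alternating_iter i MK NK My) fconnect_iter.
have CM : {homo M : v / v \in C}.
  move=> v vC; have := CN v vC; rewrite !inE => /connect_trans; apply.
  by rewrite -{2}(NK v) fconnect1.
have N'U := matching_mix CM CN MU NU.
have N'k : msize (mix C M N) = k.
  (* The two mixtures have total size [2k] and neither exceeds [k]. *)
  have := msize_mix C M N; have := max_k N'U.
  by have := max_k (matching_mix CN CM NU MU); lia.
have yC : y \in C by rewrite inE connect0.
have N'y : mix C M N y = y by rewrite ffunE yC.
have [xC | xC] := boolP (x \in C); last first.
  have N'x : mix C M N x = x by rewrite ffunE (negbTE xC).
  suff: ~~ joined x y by rewrite xy.
  apply/joinedPn; split; last by exists (mix C M N).
  by apply: contraNneq xC => ->.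
have zC : z \notin C.
  apply: contraNN neq_xz; move: xC Nx Nz; rewrite !inE.
  move=> /iter_findex <- Ni Nj /iter_findex zE; move: Nj; rewrite -zE => Nj.
  by apply/eqP; apply: alternating_end Ni Nj.
have N'z : mix C M N z = z by rewrite ffunE (negbTE zC).
suff: ~~ joined y z by rewrite yz.
apply/joinedPn; split; last by exists (mix C M N).
by apply: contraNneq zC => <-.
Qed.

(** A maximum matching missing both ends of an edge could be enlarged by that edge. *)
Lemma edge_joined x y : x \in U -> y \in U -> e x y -> joined x y.
Proof.
wlog lt_xy : x y / x < y.
  move=> H xU yU exy; have: x != y by apply: contraTneq exy => ->.
  rewrite -val_eqE neq_ltn => /orP[] ?; first exact: H.
  by rewrite joined_sym H // e_sym.
move=> xU yU exy; apply: contraT => /joinedPn[neq_xy [m [mU mk] [mx my]]].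
have [mK me] := matching_inP _ _ mU.
pose m' : {ffun 'I_n -> 'I_n} :=
  [ffun z => if z == x then y else if z == y then x else m z].
have m'U : matching_in U m'.
  apply/matching_inP; split=> z; rewrite !ffunE.
    have [->|zx] := eqVneq z x; first by rewrite eq_sym (negbTE neq_xy) eqxx.
    have [->|zy] := eqVneq z y; first by rewrite eqxx.
    have -> : (m z == x) = false.
      by apply: contraNF zx => /eqP mz; rewrite -(mK z) mz mx.
    have -> : (m z == y) = false.
      by apply: contraNF zy => /eqP mz; rewrite -(mK z) mz my.
    by rewrite mK.
  have [->|zx] := eqVneq z x; first by [].
  have [->|zy] := eqVneq z y; first by rewrite e_sym.
  exact: me.
suff: msize m' = k.+1 by have := max_k m'U; lia.
rewrite /msize [X in #|pred_of_set X|](_ : _ = x |: [set z : 'I_n | z < m z]).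
  by rewrite cardsU1 inE mx ltnn /= add1n -mk.
apply/setP => z; rewrite !inE ffunE.
have [->|zx] := eqVneq z x; first by rewrite lt_xy.
by have [->|//] := eqVneq z y; rewrite my ltnn ltnNge ltnW.
Qed.

Definition classes := equivalence_partition joined U.

Lemma classes_partition : partition classes U.
Proof.
apply: equivalence_partitionP => x y z xU yU zU; split; first exact: joined_refl.
move=> xy; apply/idP/idP; last exact: joined_trans.
by apply: joined_trans => //; rewrite joined_sym.
Qed.

Lemma joined_in_class K x y : K \in classes -> x \in K -> y \in K -> joined x y.
Proof.
move=> /imsetP[v vU ->]; rewrite !inE => /andP[xU vx] /andP[yU vy].
by apply: (joined_trans vU) => //; rewrite joined_sym.
Qed.

Lemma sum_classes : U != set0 -> \sum_(K in classes) #|K|.-1 <= k.*2.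
Proof.
case/set0Pn => v vU; have [m [mU mk] _] := missed vU.
have [mK _] := matching_inP _ _ mU.
rewrite -mk -(card_moved mK).
have [/eqP covU triv _] := and3P classes_partition.
apply: (@leq_trans (\sum_(x in U) (m x != x))); last first.
  rewrite -sum1dep_card [leqLHS]big_mkcond [leqRHS]big_mkcond.
  by apply: leq_sum => x _; case: (x \in U); case: (m x != x).
rewrite -covU big_trivIset //=; apply: leq_sum => K KP.
(* Two missed vertices of one class would contradict [joined], so [m] moves at least [#|K| - 1]
   vertices of [K], out of [2k] in all. *)
have le1 : \sum_(x in K) (m x == x) <= 1.
  rewrite -big_mkcondr sum1dep_card; apply/card_le1_eqP => x y.
  rewrite !inE => /andP[xK /eqP mx] /andP[yK /eqP my].
  apply/eqP/contraT => neq_xy; have := joined_in_class KP xK yK.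
  by apply: contraLR => _; apply/joinedPn; split; [rewrite eq_sym | exists m].
have: \sum_(x in K) (m x == x) + \sum_(x in K) (m x != x) = #|K|.
  by rewrite -big_split -sum1_card; apply: eq_bigr => x _; case: (m x == x).
by move=> <-; rewrite -subn1 leq_subLR leq_add2r.
Qed.

End Gallai.
End Matchings.

(** * Degree sums and the codegree count in a C4-free graph *)

Section Degrees.
Variables (n : nat) (e : rel 'I_n).
Hypotheses (e_irr : forall x, ~~ e x x) (e_sym : forall x y, e x y = e y x).
Implicit Types A B : {set 'I_n}.

Definition deg A (v : 'I_n) := #|[set x in A | e v x]|.

Lemma degE A v : deg A v = \sum_(x in A) e v x.
Proof. by rewrite /deg -sum1dep_card big_mkcondr /=; apply: eq_bigr => x _; case: (e v x). Qed.

Lemma sum_deg_sym A B : \sum_(v in A) deg B v = \sum_(v in B) deg A v.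
Proof.
under eq_bigr do rewrite degE; rewrite exchange_big; apply: eq_bigr => v _.
by rewrite degE; apply: eq_bigr => x _; rewrite e_sym.
Qed.

Lemma sum_deg_split A B :
  \sum_(v in A) deg setT v = \sum_(v in A) deg B v + \sum_(v in A) deg (~: B) v.
Proof.
rewrite -big_split; apply: eq_bigr => v _ /=; rewrite !degE.
rewrite (bigID (mem B)) /=; congr (_ + _); apply: eq_bigl => x; rewrite ?inE //.
Qed.

Lemma sum_deg_num_edges : \sum_v deg setT v = (num_edges e).*2.
Proof.
have numE : num_edges e = \sum_(x : 'I_n) \sum_(y : 'I_n) ((x < y) && e x y).
  rewrite /num_edges -sum1dep_card big_mkcond pair_bigA /=.
  by apply: eq_bigr => -[x y] _ /=; case: (_ && _).
rewrite -addnn {2}numE exchange_big numE -big_split; apply: eq_bigr => x _ /=.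
rewrite -big_split degE (eq_bigl predT) => [|y]; last by rewrite inE.
apply: eq_bigr => y _ /=.
rewrite (e_sym y); case: ltngtP => [||/val_inj ->]; rewrite ?addn0 //.
by rewrite (negbTE (e_irr y)).
Qed.

Lemma card_ordered_pairs A :
  \sum_(x in A) \sum_(y in A | y != x) 1 = #|A| * (#|A| - 1).
Proof.
rewrite -sum_nat_const; apply: eq_bigr => x xA; rewrite sum1dep_card.
rewrite (cardsD1 x A) xA /= add1n subn1; apply: eq_card => y.
by rewrite !inE andbC.
Qed.

(** Double counting of triples [(v, x, y)] with [x], [y] distinct neighbours of [v] in [A]: two
    common neighbours [v], [w] of [x], [y] would close the 4-cycle [x v y w]. *)
Lemma sum_codegrees A : ~ has_C4 e ->
  \sum_v deg A v * (deg A v - 1) <= #|A| * (#|A| - 1).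
Proof.
move=> noC4.
have -> : \sum_v deg A v * (deg A v - 1) =
    \sum_(x in A) \sum_(y in A | y != x) \sum_v (e v x && e v y).
  under [RHS]eq_bigr do rewrite exchange_big; rewrite exchange_big /=.
  apply: eq_bigr => v _; rewrite -card_ordered_pairs.
  rewrite big_mkcond [RHS]big_mkcond; apply: eq_bigr => x _; rewrite inE.
  case: (x \in A) => //=; case: (e v x) => /=; last by rewrite big1.
  rewrite big_mkcond [RHS]big_mkcond; apply: eq_bigr => y _; rewrite inE.
  by case: (y \in A) => //=; case: (e v y); case: (y != x).
rewrite -card_ordered_pairs; apply: leq_sum => x xA; apply: leq_sum => y.
case/andP=> yA yx.
have -> : \sum_v (e v x && e v y) = #|[set v | e v x && e v y]|.
  by rewrite -sum1dep_card [RHS]big_mkcond; apply: eq_bigr => v _; case: (_ && _).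
apply/card_le1_eqP => v w; rewrite !inE => /andP[vx vy] /andP[wx wy].
apply/eqP/contraT => neq_vw; case: noC4; exists x, v, y, w.
have neqe a b : e a b -> (a == b) = false.
  by move=> eab; apply/eqP => ab; move: eab (e_irr a); rewrite -ab => ->.
split; rewrite // 1?e_sym //= !inE !negb_or (eq_sym x v) (eq_sym x w).
rewrite (neqe _ _ vx) (neqe _ _ wx) (neqe _ _ vy).
by rewrite (eq_sym x) yx (eq_sym v) neq_vw (eq_sym y) (neqe _ _ wy).
Qed.
End Degrees.

(** * The numerical inequality behind the upper bound *)

Lemma double_bin2 s : 'C(s, 2).*2 + s = s * s.
Proof. by elim: s => // s IHs; rewrite binS bin1; lia. Qed.

(** Here [t] stands for [#|S|], [E] for the number of edges and [F] for twice the number of edges of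
    G - S. *)
Lemma edge_bound_arith s t n E F (X := maxn (s - t).*2 20) :
  12 <= s -> 'C(s, 2) + s + 1 <= n -> t <= s -> 
  (0 < t -> E.*2 <= n.*2 + t * t - t.*2 + F) ->
  (t = 0 -> E.*2 = F) ->
  8 * X * F <= (s - t).*2 * (X.+1 * (X + 20)) ->
  E <= n + 'C(s, 2) - uphalf s.
Proof.
move=> s12 nC ts Et E0 FX; have binE := double_bin2 s.
have uE : (uphalf s).*2 <= s.+1 by lia.
(* For [s - t <= 9], [X = 20] gives [F <= 10.5 (s - t)]; otherwise [X = 2 (s - t)] cancels. *)
have {FX} Fk : F <= 11 * (s - t) \/ 10 <= s - t /\ 8 * F <= (s - t).*2.+1 * ((s - t).*2 + 20).
  move: FX; rewrite /X; case: (leqP (s - t) 9) => k10.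
    by rewrite (maxn_idPr _); [left; lia | lia].
  rewrite (maxn_idPl _); last by lia.
  by rewrite mulnAC mulnC leq_pmul2l; [right | lia].
(* For [t = 0] the bound on [E] is quadratic in [s], and the lower bound on [n] absorbs it. *)
have [t0 | t_gt0] := posnP t.
  have s2 : 12 * s <= s * s by rewrite leq_mul2r s12 orbT.
  by move: (E0 t0) Fk; rewrite t0 subn0 => EF [|[_]]; lia.
have {Et} Et := Et t_gt0.
move: (s - t) (subnK ts) Fk => k sE Fk; rewrite -{}sE in s12 nC binE uE *.
(* With [s = t + k] this says [t^2 - 2t + F <= s^2 - 2s]; for odd [s] the rounding in [uphalf] is
   covered by integrality of [E]. *)
suff: F + k.*2 <= k * k + (k * t).*2 by lia.
case: Fk => [Fk | [k10 Fk]].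
  (* Here [13 = 11 + 2], and [k + 2t = s + t >= 13]. *)
  suff: 13 * k <= (k + t.*2) * k by lia.
  by rewrite leq_mul2r; apply/orP; right; lia.
have kt : k <= k * t by rewrite leq_pmulr.
(* For [k = 10], [s >= 12] forces [t >= 2], which is enough; from [k = 11] on, [t >= 1] suffices. *)
have [k10E | k11] := eqVneq k 10; first by subst k; lia.
suff: 11 * k <= k * k by lia.
by rewrite leq_mul2r; apply/orP; right; lia.
Qed.

(** * The upper bound on the number of edges *)

Section UpperBound.
Variables (n : nat) (e : rel 'I_n).
Hypotheses (e_irr : forall x, ~~ e x x) (e_sym : forall x y, e x y = e y x).
Hypothesis noC4 : ~ has_C4 e.

(** The left side is twice the number of edges meeting [S]. The codegree count applies through
    [d <= 1 + d(d - 1)] inside [S] and [2d <= 2 + d(d - 1)] outside. *)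
Lemma sum_deg_meet_set (S : {set 'I_n}) :
  \sum_(v in S) deg e S v + (\sum_(v in ~: S) deg e S v).*2 <=
    #|S| + #|~: S|.*2 + #|S| * (#|S| - 1).
Proof.
apply: leq_trans (leq_add (leqnn _) (sum_codegrees e_irr e_sym S noC4)).
have insideE : \sum_(v in S) deg e S v <=
    #|S| + \sum_(v in S) deg e S v * (deg e S v - 1).
  by rewrite -sum1_card -big_split; apply: leq_sum => v _ /=; nia.
have outsideE : (\sum_(v in ~: S) deg e S v).*2 <=
    #|~: S|.*2 + \sum_(v in ~: S) deg e S v * (deg e S v - 1).
  rewrite -mul2n big_distrr -muln2 -sum_nat_const -big_split.
  by apply: leq_sum => v _ /=; nia.
rewrite [X in _ <= _ + X](bigID (mem S)) /=.
under [X in _ <= _ + (_ + X)]eq_bigl do rewrite -in_setC.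
by apply: leq_trans (leq_add insideE outsideE) _; rewrite addnACA.
Qed.

(** The bound is linear in [#|K| - 1] so that it can be summed over the classes. With
    [x = #|K| - 1], the ratio [(x + 1)(x + 20) / x = x + 21 + 20 / x] is convex with equal values at
    1 and 20, so for [X >= 20] its maximum on [1 <= x <= X] is at [X]. *)
Lemma sum_deg_class (K : {set 'I_n}) X : 20 <= X -> #|K| <= X.+1 ->
  8 * X * \sum_(v in K) deg e K v <= #|K|.-1 * (X.+1 * (X + 20)).
Proof.
move=> X20 KX; have [K1 | K2] := leqP #|K| 1.
  rewrite big1 ?muln0 // => v vK; apply/eqP; rewrite cards_eq0; apply/eqP/setP => x.
  rewrite !inE; apply/negP => /andP[xK]; apply/negP.
  by rewrite (card_le1_eqP K1 v x vK xK).
have: 8 * \sum_(v in K) deg e K v <= #|K| * (#|K| - 1) + #|K| * 20.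
  apply: leq_trans (leq_add (sum_codegrees e_irr e_sym K noC4) (leqnn _)).
  rewrite [X in _ <= X + _](bigID (mem K)) /= addnAC.
  apply: leq_trans (leq_addr _ _); rewrite big_distrr -sum_nat_const -big_split.
  apply: leq_sum => v _ /=; rewrite subn1; move: (deg e K v) => d.
  (* This is [8d <= d(d - 1) + 20], with equality at [d = 4] and [d = 5]. *)
  by do 5 (case: d => [//|d]); rewrite /=; lia.
case: #|K| K2 KX => // x x_gt0 xX; rewrite subn1 /= => D.
have: X * (x.+1 * x + x.+1 * 20) <= x * (X.+1 * (X + 20)).
  have [y XE] : exists y, X = x + y by exists (X - x); lia.
  suff: y * 20 <= y * (x * X) by rewrite XE; lia.
  by rewrite leq_mul2l (leq_trans X20) ?orbT // leq_pmull //; lia.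
by apply: leq_trans; rewrite mulnAC mulnC leq_mul2l D orbT.
Qed.

Lemma num_edges_ub s : 12 <= s -> 'C(s, 2) + s + 1 <= n ->
  ~ has_matching e s.+1 -> num_edges e <= n + 'C(s, 2) - uphalf s.
Proof.
move=> s12 nC noM.
pose P (S : {set 'I_n}) :=
  [forall m, matching_in e (~: S) m ==> (#|S| + msize m <= s)].
have P0 : P set0.
  apply/forallP => m; apply/implyP; rewrite setC0 cards0 => mT.
  rewrite add0n leqNgt; apply/negP => sm; apply: noM.
  exact: matching_of_msize mT sm.
case: (arg_maxnP (fun S : {set 'I_n} => #|S|) P0) => S PS maxS.
pose k := s - #|S|.
have PSm m : matching_in e (~: S) m -> #|S| + msize m <= s.
  by move: m; move/forallP: PS => PS m; apply/implyP.
have idm : matching_in e (~: S) [ffun x => x].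
  by apply/matching_inP; split=> x; rewrite !ffunE // eqxx.
have Ss : #|S| <= s by have := PSm _ idm; lia.
have max_k m : matching_in e (~: S) m -> msize m <= k.
  by move/PSm; rewrite /k; lia.
have missed v : v \in ~: S ->
    exists2 m, matching_in e (~: S) m /\ msize m = k & m v = v.
  (* By maximality of [S], adding [v] violates [P]: some matching avoiding [S] and [v] has at least
     [k] edges. *)
  rewrite inE => vS; have: ~~ P (v |: S).
    by apply/negP => /maxS; rewrite /= cardsU1 vS add1n ltnn.
  rewrite negb_forall => /existsP[m]; rewrite negb_imply -ltnNge cardsU1 vS.
  case/andP => /matching_inP[mK me] km.
  have mU : matching_in e (~: S) m.
    apply/matching_inP; split=> // x /me[]; rewrite !inE negb_or.
    by case/andP.
  exists m; first by split=> //; have := PSm _ mU; rewrite /k; lia.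
  by apply/eqP; apply: contraT => /me[]; rewrite !inE eqxx.
pose U := ~: S; pose F := \sum_(v in U) deg e U v.
pose X := maxn k.*2 20.
have FX : 8 * X * F <= k.*2 * (X.+1 * (X + 20)).
  have [U0 | Un0] := eqVneq U set0; first by rewrite /F U0 big_set0 muln0.
  have [/eqP covU triv _] := and3P (classes_partition max_k missed).
  rewrite -/U in covU triv; have sumK := sum_classes max_k missed Un0.
  apply: leq_trans (leq_mul sumK (leqnn _)).
  (* Edges inside [U] never leave a class, so degrees in [U] are degrees in the own class. *)
  have -> : F = \sum_(K in classes e U k) \sum_(v in K) deg e K v.
    rewrite /F -{1}covU big_trivIset //=; apply: eq_bigr => K KP.
    apply: eq_bigr => v vK; apply: eq_card => x; rewrite !inE.
    have KU : K \subset U by rewrite -covU; apply: bigcup_sup.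
    have [evx | _] := boolP (e v x); last by rewrite !andbF.
    rewrite !andbT; apply/idP/idP => [xU|]; last first.
      by move/(subsetP KU); rewrite inE.
    have xU' : x \in U by rewrite inE.
    have vU := subsetP KU v vK.
    have vx := edge_joined e_irr e_sym max_k vU xU' evx.
    move: KP vK => /imsetP[w wU ->]; rewrite !inE => /andP[_ wv].
    by rewrite xU (joined_trans max_k missed vU wv).
  rewrite big_distrr big_distrl; apply: leq_sum => K KP /=.
  apply: sum_deg_class; first exact: leq_maxr.
  move: sumK; rewrite (bigD1 K) //= => /(leq_trans (leq_addr _ _)).
  by case: #|K| => [|x] //= xk; rewrite ltnS (leq_trans xk) ?leq_maxl.
apply: (edge_bound_arith s12 nC Ss _ _ FX) => [_ | /eqP].
  rewrite -(sum_deg_num_edges e_irr e_sym) (bigID (mem S)) /=.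
  under [X in _ + X]eq_bigl do rewrite -in_setC.
  rewrite !(sum_deg_split _ _ S) (sum_deg_sym e_sym S (~: S)) -/U -/F.
  have := sum_deg_meet_set S; have := cardsC S; rewrite card_ord -/U.
  have : #|S| * (#|S| - 1) + #|S| = #|S| * #|S| by nia.
  rewrite addnA -[_ + _ + \sum_(v in U) _]addnA addnn leq_add2r.
  move=> sqS cardU /leq_trans; apply; move: sqS cardU.
  by clear; move: #|S| #|U| => t u; lia.
rewrite cards_eq0 => /eqP S0.
rewrite -(sum_deg_num_edges e_irr e_sym) /F /U S0 setC0.
by apply: eq_bigl => x; rewrite inE.
Qed.
End UpperBound.

(** * The extremal graph *)

Section Construction.
Variables (s n : nat) (x0 : 'I_n).
Hypotheses (s_gt0 : 0 < s) (x0_0 : x0 = 0 :> nat) (le_n : 'C(s, 2) + s <= n).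

Definition core := [set x : 'I_n | x < s].

Definition core_pairs := enum [set A : {set 'I_n} | (A \subset core) && (#|A| == 2)].

(* The default value of [nth] hangs the surplus outer vertices on [x0]. *)
Definition attach (y : 'I_n) := nth [set x0] core_pairs (y - s).

(** Pairs [2i] with [2i + 1]; for odd [s] the core vertex [s - 1] has no mate in the core. *)
Definition mate (x y : 'I_n) := (x != y) && (x./2 == y./2).

Definition extremal : rel 'I_n := fun x y =>
  [|| [&& x \in core, y \in core & mate x y],
      [&& x \in core, y \notin core & x \in attach y] |
      [&& y \in core, x \notin core & y \in attach x]].

Lemma card_core : #|core| = s.
Proof.
have le_sn : s <= n by lia.
by rewrite /core -sum1dep_card (big_ord_narrow le_sn) sum1_card card_ord.
Qed.

Lemma size_core_pairs : size core_pairs = 'C(s, 2).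
Proof. by rewrite -cardE cards_draws card_core. Qed.

Lemma attach_core y : attach y \subset core.
Proof.
rewrite /attach; have [lt_y | ge_y] := ltnP (y - s) (size core_pairs).
  by have := mem_nth [set x0] lt_y; rewrite mem_enum inE => /andP[].
by rewrite nth_default // sub1set inE x0_0.
Qed.

Lemma card_attach y : #|attach y| = if y - s < 'C(s, 2) then 2 else 1.
Proof.
rewrite -size_core_pairs /attach; case: ltnP => [lt_y | ge_y].
  by have := mem_nth [set x0] lt_y; rewrite mem_enum inE => /andP[_ /eqP].
by rewrite nth_default // cards1.
Qed.

Lemma extremal_simple : simple_graph extremal.
Proof.
split=> [x | x y]; first by rewrite /extremal /mate eqxx !andbF /=; case: (x \in core).
rewrite /extremal /mate eq_sym (eq_sym (x./2)).
by case: (x \in core); case: (y \in core) => //=; rewrite !orbF.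
Qed.

Lemma extremal_core x y : extremal x y -> (x \in core) || (y \in core).
Proof. by rewrite /extremal; case: (x \in core); case: (y \in core). Qed.

(** A core vertex has at most one mate, so a common neighbour [u] lies outside the core. Then
    [attach u] is exactly the pair [a], [b], which occurs once in [core_pairs]. *)
Lemma extremal_codegree a b v w : a \in core -> b \in core -> a != b ->
  extremal v a -> extremal v b -> extremal w a -> extremal w b -> v = w.
Proof.
have nocore u : a \in core -> b \in core -> a != b ->
    extremal u a -> extremal u b -> u \notin core /\ [set a; b] \subset attach u.
  move=> ac bc ab; rewrite /extremal ac bc /=; case uc: (u \in core) => /=.
    move: ab; rewrite !orbF /mate -!val_eqE /= => ab /andP[ua /eqP ha] /andP[ub /eqP hb].
    by lia.
  by move=> ua ub; rewrite subUset !sub1set ua ub.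
move=> ac bc ab va vb wa wb.
have [vc vab] := nocore v ac bc ab va vb.
have [wc wab] := nocore w ac bc ab wa wb.
have attE u : [set a; b] \subset attach u -> u - s < 'C(s, 2) /\ attach u = [set a; b].
  move=> abu; have := subset_leq_card abu; rewrite cards2 ab card_attach.
  case: (ltnP (u - s)) => // lt_u _; split=> //.
  by apply/eqP; rewrite eq_sym eqEcard abu card_attach lt_u cards2 ab.
have [ltv vE] := attE v vab; have [ltw wE] := attE w wab.
have: attach v == attach w by rewrite vE wE.
rewrite /attach nth_uniq ?size_core_pairs ?enum_uniq // => /eqP vw.
by apply: val_inj => /=; move: vc wc; rewrite !inE; lia.
Qed.

(** Outer vertices are pairwise non-adjacent, so one diagonal of a 4-cycle lies in the core, and its
    ends would have two common neighbours. *)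
Lemma extremal_noC4 : ~ has_C4 extremal.
Proof.
move=> [a [b [c [d [U ab bc cd da]]]]].
have sym := extremal_simple.2.
have diag u v w z : u \in core -> w \in core -> u != w -> v != z ->
    extremal u v -> extremal v w -> extremal w z -> extremal z u -> False.
  move=> uc wc uw vz uv vw wz zu; move/eqP: vz; apply.
  by apply: (extremal_codegree uc wc uw) => //; rewrite sym.
move: U; rewrite /= !inE !negb_or => /and4P[/and3P[nab nac nad] /andP[nbc nbd] ncd _].
have [ac | ac] := boolP (a \in core); first have [cc | cc] := boolP (c \in core).
- exact: (diag a b c d).
- have := extremal_core bc; have := extremal_core cd.
  by rewrite (negbTE cc) /= orbF => dc bc'; apply: (diag b c d a) => //; rewrite eq_sym.
- have := extremal_core ab; have := extremal_core da.
  by rewrite (negbTE ac) /= orbF => dc bc'; apply: (diag b c d a) => //; rewrite eq_sym.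
Qed.

Lemma extremal_no_matching : ~ has_matching extremal s.+1.
Proof.
move=> [f [fe]]; rewrite cat_uniq => /and3P[U1 /hasPn dis U2].
have /injectiveP f1_inj : injectiveb (fun i => (f i).1) := U1.
have /injectiveP f2_inj : injectiveb (fun i => (f i).2) := U2.
have f12 i j : (f i).1 <> (f j).2.
  move=> fij; have /dis/negP[] : (f j).2 \in [seq (f i).2 | i <- enum 'I_s.+1].
    by apply: map_f; rewrite mem_enum.
  by rewrite /= -fij; apply: map_f; rewrite mem_enum.
(* The core is a vertex cover of size [s]; [h] selects a core end of each matching edge. *)
pose h i := if (f i).1 \in core then (f i).1 else (f i).2.
have h_inj : injective h.
  move=> i j; rewrite /h; case: ifP => _; case: ifP => _.
  - exact: f1_inj.
  - by move/f12.
  - by move/esym/f12.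
  - exact: f2_inj.
have: h @: setT \subset core.
  apply/subsetP => _ /imsetP[i _ ->]; rewrite /h; case: ifP => // ic.
  by have := extremal_core (fe i); rewrite ic.
move/subset_leq_card; rewrite card_core card_imset // cardsT card_ord.
by rewrite ltnn.
Qed.

(** Edges are counted at their larger end: an odd core vertex sees its mate [y - 1], and an outer
    vertex sees all of [attach y]. *)
Lemma card_before (y : 'I_n) :
  #|[set x : 'I_n | (x < y) && extremal x y]| =
    if y < s then odd y : nat else if y - s < 'C(s, 2) then 2 else 1.
Proof.
case: ifP => ys; last first.
  rewrite -card_attach; apply: eq_card => x; rewrite !inE /extremal !inE ys.
  rewrite andbF orbF /=; have [xs | xs] := ltnP x s.
    by rewrite (_ : x < y) //; lia.
  rewrite andbF; apply/esym/negP => /(subsetP (attach_core y)).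
  by rewrite inE ltnNge xs.
have [oy | ey] := boolP (odd y); last first.
  apply/eqP; rewrite cards_eq0; apply/eqP/setP => x; rewrite !inE /extremal !inE ys.
  apply/negP => /andP[xy]; rewrite /mate (leq_trans xy (ltnW ys)) /= orbF.
  by case/andP => _ /eqP; lia.
have py : y.-1 < n by have := ltn_ord y; lia.
rewrite [RHS]/= -(cards1 (Ordinal py)); apply: eq_card => x.
rewrite !inE /extremal !inE ys /mate -!val_eqE /=.
by apply/idP/eqP; lia.
Qed.

Lemma num_edges_extremal : num_edges extremal = n + 'C(s, 2) - uphalf s.
Proof.
have -> : num_edges extremal =
    \sum_(y : 'I_n) #|[set x : 'I_n | (x < y) && extremal x y]|.
  rewrite /num_edges -sum1dep_card big_mkcond.
  rewrite -(pair_bigA _ (fun x y : 'I_n => if (x < y) && extremal x y then 1 else 0)).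
  rewrite exchange_big; apply: eq_bigr => y _ /=.
  by rewrite -sum1dep_card -big_mkcond.
under eq_bigr do rewrite card_before.
(* The range is freed from [n] for the induction; at [m = n] both minima are attained by their
   second argument. *)
have sumE m : \sum_(y < m)
      (if y < s then odd y : nat else if y - s < 'C(s, 2) then 2 else 1) =
    (minn m s)./2 + (m - s) + minn (m - s) 'C(s, 2).
  elim: m => [|m IHm]; first by rewrite big_ord0 min0n sub0n min0n.
  by rewrite big_ord_recr /= {}IHm; do 2?case: ifP; lia.
by rewrite sumE; lia.
Qed.
End Construction.

Theorem theorem1p3 (s n : nat) :
  12 <= s -> 'C(s, 2) + s + 1 <= n ->
  is_ex_C4_M n s (n + 'C(s, 2) - uphalf s).
Proof.
move=> s12 nC; split; last first.
  by move=> e [e_irr e_sym] [noC4 noM]; apply: num_edges_ub.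
have s_gt0 : 0 < s by lia.
have n_gt0 : 0 < n by lia.
have le_n : 'C(s, 2) + s <= n by lia.
pose x0 := Ordinal n_gt0.
exists (extremal s x0); split.
- exact: extremal_simple.
- by split; [exact: extremal_noC4 | exact: extremal_no_matching].
- exact: num_edges_extremal.
Qed.
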